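(* A torsion-free group $G$ is algebraically hyperbolic (AH) if and only if $G$ is $\mathrm{BS}$-free, Gildenhuys-free, and Adian-free.
   Context: A group is locally cyclic if each of its non-trivial finitely generated subgroups is isomorphic to $\mathbb{Z}$ (equivalently, it is isomorphic to a subgroup of $(\mathbb{Q},+)$). A group $G$ is commutative-transitive if for all $g,h,k\in G\smallsetminus\{1\}$, $[g,h]=1$ and $[h,k]=1$ imply $[g,k]=1$. A torsion-free group $G$ is algebraically hyperbolic (AH) if (a) $G$ is commutative-transitive, and (b) $G$ contains no subgroup of the form $H\rtimes\mathbb{Z}$ with $H$ non-trivial locally cyclic. A group is $\mathrm{BS}$-free if it contains no subgroup isomorphic to a Baumslag--Solitar group $\mathrm{BS}(m,n)=\langle a,t\mid t^{-1}a^mt=a^n\rangle$, $m,n\in\mathbb{Z}\smallsetminus\{0\}$. For non-zero coprime integers $m,n$, let $G_{m,n}=\mathbb{Z}[1/mn]\rtimes\mathbb{Z}$, where $\mathbb{Z}[1/mn]\leqslant(\mathbb{Q},+)$ is the subgroup of fractions of the form $\frac{x}{m^pn^q}$ ($x,p,q\in\mathbb{Z}$) and the generator of the $\mathbb{Z}$-factor acts as multiplication by $m/n$. If $|m|,|n|>1$ then $G_{m,n}$ is called a Gildenhuys group. A group is Gildenhuys-free if it contains no Gildenhuys group as a subgroup. An Adian extension is a finitely generated torsion-free group which maps onto an infinite torsion group with cyclic kernel. A group is Adian-free if it contains no Adian extension as a subgroup. *)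

(* Defs.v *)
From HB Require Import structures.
From mathcomp Require Import all_boot all_order all_algebra.
From mathcomp Require Import ring zify.
From mathcomp Require Import generic_quotient boolp classical_sets cardinality.

Set Implicit Arguments.
Unset Strict Implicit.
Unset Printing Implicit Defensive.

Import GRing.Theory Num.Theory.

Local Open Scope quotient_scope.
Local Open Scope group_scope.

(* Subgroups are the [groupClosed] predicates of MathComp; classically a       *)
(* boolean predicate is an arbitrary subset. [subgroup H] is H regarded as a   *)
(* group in its own right.                                                     *)
Section Subgroup.
Variables (G : groupType) (H : groupClosed G).

Definition subgroup : Type := {x : G | x \in H}.

HB.instance Definition _ := SubChoice.on subgroup.

Lemma groupClosedP : group_closed H.
Proof. by split; [exact: gpred1 | exact: gpredF]. Qed.

HB.instance Definition _ :=
  SubChoice_isSubGroup.Build G (fun x => x \in H) subgroup groupClosedP.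

End Subgroup.

Lemma hom1 (A B : groupType) (f : {multiplicative A -> B}) : f 1 = 1.
Proof. by apply: (mulgI (f 1)); rewrite -gmulfM !mulg1. Qed.

Definition isomorphic (A B : groupType) : Prop :=
  exists f : {multiplicative A -> B}, bijective f.

Definition has_subgroup_iso (G B : groupType) : Prop :=
  exists H : groupClosed G, isomorphic (subgroup H) B.

(* No proper subgroup contains s. *)
Definition generates (G : groupType) (s : seq G) : Prop :=
  forall H : groupClosed G, {subset s <= H} -> forall x : G, x \in H.

Definition finitely_generated (G : groupType) : Prop :=
  exists s : seq G, generates s.

Definition cyclic_group (G : groupType) : Prop :=
  exists z : G, generates [:: z].

Definition nontrivial (G : groupType) : Prop := exists x : G, x <> 1.

Definition torsion_free (G : groupType) : Prop :=
  forall (x : G) (n : nat), (0 < n)%N -> x ^+ n = 1 -> x = 1.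

Definition torsion_group (G : groupType) : Prop :=
  forall x : G, exists2 n : nat, (0 < n)%N & x ^+ n = 1.

Definition Zgroup : groupType := Algebra.to_multiplicative int.

Definition locally_cyclic (G : groupType) : Prop :=
  forall K : groupClosed G,
    finitely_generated (subgroup K) -> nontrivial (subgroup K) ->
    isomorphic (subgroup K) Zgroup.

Definition commutative_transitive (G : groupType) : Prop :=
  forall g h k : G, g <> 1 -> h <> 1 -> k <> 1 ->
    [~ g, h] = 1 -> [~ h, k] = 1 -> [~ g, k] = 1.

(* An action of K on H by automorphisms, i.e., a homomorphism K -> Aut H; each *)
(* [autact phi k] is invertible, with inverse [autact phi k^-1].               *)
Record aut_action (K H : groupType) := AutAction {
  autact : K -> {multiplicative H -> H};
  autact1 : forall h, autact 1 h = h;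
  autactM : forall k l h, autact (k * l) h = autact k (autact l h)
}.

(* The external semidirect product of H by K; in it, k h k^-1 is the image of  *)
(* h under the automorphism attached to k.                                     *)
Section SemiDirect.
Variables (H K : groupType) (phi : aut_action K H).

Definition semidirect of aut_action K H : Type := (H * K)%type.

HB.instance Definition _ := Choice.on (semidirect phi).

Definition sd_mul (x y : semidirect phi) : semidirect phi :=
  (x.1 * autact phi x.2 y.1, x.2 * y.2).
Definition sd_one : semidirect phi := (1, 1).
Definition sd_inv (x : semidirect phi) : semidirect phi :=
  (autact phi x.2^-1 x.1^-1, x.2^-1).

Lemma sd_mulA : associative sd_mul.
Proof.
by move=> [a k] [b l] [c j]; rewrite /sd_mul /= gmulfM autactM !mulgA.
Qed.

Lemma sd_mul1g : left_id sd_one sd_mul.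
Proof. by move=> [a k]; rewrite /sd_mul /= autact1 !mul1g. Qed.

Lemma sd_mulg1 : right_id sd_one sd_mul.
Proof. by move=> [a k]; rewrite /sd_mul /= hom1 !mulg1. Qed.

Lemma sd_mulVg : left_inverse sd_one sd_inv sd_mul.
Proof.
by move=> [a k]; rewrite /sd_mul /= -gmulfM !mulVg hom1.
Qed.

Lemma sd_mulgV : right_inverse sd_one sd_inv sd_mul.
Proof.
by move=> [a k]; rewrite /sd_mul /= -autactM !mulgV autact1 mulgV.
Qed.

HB.instance Definition _ := isGroup.Build (semidirect phi)
  sd_mulA sd_mul1g sd_mulg1 sd_mulVg sd_mulgV.

End SemiDirect.

Definition algebraically_hyperbolic (G : groupType) : Prop :=
  [/\ torsion_free G,
      commutative_transitive G
    & ~ exists (H : groupType) (phi : aut_action Zgroup H),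
        [/\ nontrivial H, locally_cyclic H
          & has_subgroup_iso G (semidirect phi)]].

(* The group presented by generators X and relations u = v for R u v. A letter *)
(* (x, false) stands for x and (x, true) for x^-1; two words are identified    *)
(* when they are related by the congruence generated by x x^-1 = x^-1 x = 1    *)
(* and the relations.                                                          *)
Section Presentation.
Variables (X : choiceType) (R : seq (X * bool) -> seq (X * bool) -> Prop).

Definition word : Type := seq (X * bool).
HB.instance Definition _ := Choice.on word.

Inductive word_eq : word -> word -> Prop :=
| WordRefl u : word_eq u u
| WordSym u v : word_eq u v -> word_eq v u
| WordTrans v u w : word_eq u v -> word_eq v w -> word_eq u w
| WordCat u u' v v' :
    word_eq u u' -> word_eq v v' -> word_eq (u ++ v) (u' ++ v')
| WordCancel x b : word_eq [:: (x, b); (x, ~~ b)] [::]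
| WordRel u v : R u v -> word_eq u v.

Definition word_eqb : rel word := fun u v => `[< word_eq u v >].

Lemma word_eqb_refl : reflexive word_eqb.
Proof. by move=> u; apply/asboolP; exact: WordRefl. Qed.

Lemma word_eqb_sym : symmetric word_eqb.
Proof. by move=> u v; apply/asboolP/asboolP; exact: WordSym. Qed.

Lemma word_eqb_trans : transitive word_eqb.
Proof.
by move=> v u w /asboolP uv /asboolP vw; apply/asboolP; exact: WordTrans uv vw.
Qed.

Canonical word_equiv :=
  EquivRel word_eqb word_eqb_refl word_eqb_sym word_eqb_trans.

Definition presented : Type := {eq_quot word_equiv}.
HB.instance Definition _ := Choice.on presented.
HB.instance Definition _ := EqQuotient.on presented.

Definition word_inv (u : word) : word := rev [seq (l.1, ~~ l.2) | l <- u].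

Definition pres_mul (p q : presented) : presented :=
  \pi_presented (repr p ++ repr q).
Definition pres_one : presented := \pi_presented [::].
Definition pres_inv (p : presented) : presented :=
  \pi_presented (word_inv (repr p)).

Lemma pi_word (u v : word) :
  word_eq u v -> \pi_presented u = \pi_presented v.
Proof. by move=> uv; apply/(@eqquotP _ _ presented)/asboolP. Qed.

Lemma repr_word (u : word) : word_eq (repr (\pi_presented u)) u.
Proof. by apply/asboolP/(@eqquotP _ _ presented); rewrite reprK. Qed.

Lemma word_mulV (u : word) : word_eq (u ++ word_inv u) [::].
Proof.
elim: u => [|[x b] u IHu]; first exact: WordRefl.
rewrite /word_inv /= rev_cons -cats1 -/(word_inv u) catA -cat1s.
rewrite -[X in word_eq _ X]cats0 -catA.
have e1 : word_eq ((u ++ word_inv u) ++ [:: (x, ~~ b)]) [:: (x, ~~ b)].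
  by apply: (WordCat (u' := [::])) => //; exact: WordRefl.
apply: (@WordTrans ([:: (x, b)] ++ [:: (x, ~~ b)])); last exact: WordCancel.
by apply: WordCat; [exact: WordRefl | rewrite -catA in e1].
Qed.

Lemma word_invK : involutive word_inv.
Proof.
move=> u; rewrite /word_inv map_rev revK -map_comp -[RHS]map_id.
by apply: eq_map => -[x b] /=; rewrite negbK.
Qed.

Lemma pres_mulA : associative pres_mul.
Proof.
move=> p q r; apply: pi_word.
apply: (@WordTrans (repr p ++ (repr q ++ repr r))).
  by apply: WordCat; [exact: WordRefl | exact: repr_word].
by rewrite catA; apply: WordCat; [exact/WordSym/repr_word | exact: WordRefl].
Qed.

Lemma pres_mul1g : left_id pres_one pres_mul.
Proof.
move=> p; rewrite -[RHS]reprK; apply: pi_word.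
by apply: (WordCat (u' := [::])); [exact: repr_word | exact: WordRefl].
Qed.

Lemma pres_mulg1 : right_id pres_one pres_mul.
Proof.
move=> p; rewrite -[RHS]reprK; apply: pi_word; rewrite -[X in word_eq _ X]cats0.
by apply: WordCat; [exact: WordRefl | exact: repr_word].
Qed.

Lemma pres_mulgV : right_inverse pres_one pres_inv pres_mul.
Proof.
move=> p; apply: pi_word; apply: WordTrans (word_mulV (repr p)).
by apply: WordCat; [exact: WordRefl | exact: repr_word].
Qed.

Lemma pres_mulVg : left_inverse pres_one pres_inv pres_mul.
Proof.
move=> p; apply: pi_word; have := word_mulV (word_inv (repr p)).
rewrite word_invK; apply: WordTrans.
by apply: WordCat; [exact: repr_word | exact: WordRefl].
Qed.

HB.instance Definition _ := isGroup.Build presented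
  pres_mulA pres_mul1g pres_mulg1 pres_mulVg pres_mulgV.

End Presentation.

Definition word_pow (X : choiceType) (x : X) (k : int) : word X :=
  match k with
  | Posz n => nseq n (x, false)
  | Negz n => nseq n.+1 (x, true)
  end.

(* The generators a and t are [false] and [true]. *)
Definition BS_rel (m n : int) (u v : word bool) : Prop :=
  let a := false in let t := true in
  u = word_pow t (-1)%R ++ word_pow a m ++ word_pow t 1%R /\ v = word_pow a n.

Definition BS (m n : int) : groupType := presented (BS_rel m n).

Definition BS_free (G : groupType) : Prop :=
  forall m n : int, m != 0%R -> n != 0%R -> ~ has_subgroup_iso G (BS m n).

(* [Zinv m0 n0] is Z[1/mn], additive; the non-vanishing proofs are parameters  *)
(* since multiplication by m/n has to be invertible.                           *)
Section Gildenhuys.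
Local Open Scope ring_scope.
Variables (m n : int) (m0 : m != 0) (n0 : n != 0).

Definition Zinv_pred of m != 0 & n != 0 : {pred rat} := fun r =>
  `[< exists x p q : int, r = x%:~R / (m%:~R ^ p * n%:~R ^ q) >].

Lemma Zinv_predP (r : rat) :
  reflect (exists x p q : int, r = x%:~R / (m%:~R ^ p * n%:~R ^ q))
          (r \in Zinv_pred m0 n0).
Proof. exact: asboolP. Qed.

Lemma mQ0 : m%:~R != 0 :> rat. Proof. by rewrite intr_eq0. Qed.
Lemma nQ0 : n%:~R != 0 :> rat. Proof. by rewrite intr_eq0. Qed.

Lemma Zinv_pred_nat (r : rat) : r \in Zinv_pred m0 n0 ->
  exists N : nat, forall k : nat, exists x : int,
    r = x%:~R / (m%:~R ^+ (N + k) * n%:~R ^+ (N + k)).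
Proof.
have [mQ nQ] := (mQ0, nQ0).
move=> /Zinv_predP[x [p [q ->]]]; exists (`|p| + `|q|)%N => k.
set N := (`|p| + `|q| + k)%N.
have [a Na] : exists a : nat, N%:Z = p + a%:Z.
  by exists `|N%:Z - p|%N; rewrite /N; lia.
have [b Nb] : exists b : nat, N%:Z = q + b%:Z.
  by exists `|N%:Z - q|%N; rewrite /N; lia.
exists (x * m ^+ a * n ^+ b); rewrite !exprnP {1}Na Nb !expfzDr //.
rewrite !rmorphM !rmorphXn /= -!exprnP.
have mp0 : m%:~R ^ p != 0 :> rat by rewrite expfz_neq0.
have nq0 : n%:~R ^ q != 0 :> rat by rewrite expfz_neq0.
have ma0 : m%:~R ^+ a != 0 :> rat by rewrite expf_neq0.
have nb0 : n%:~R ^+ b != 0 :> rat by rewrite expf_neq0.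
move: mp0 nq0 ma0 nb0.
move: (_ ^ p) (_ ^ q) (_ ^+ a) (_ ^+ b) => P Q A B P0 Q0 A0 B0.
by field; rewrite P0 Q0 A0 B0.
Qed.

Lemma Zinv_closed : zmod_closed (Zinv_pred m0 n0).
Proof.
split; first by apply/Zinv_predP; exists 0, 0, 0; rewrite mul0r.
move=> r s /Zinv_pred_nat[M rM] /Zinv_pred_nat[N sN].
have [x ->] := rM N; have [y ->] := sN M; rewrite (addnC N).
apply/Zinv_predP; exists (x - y), (M + N)%N, (M + N)%N.
by rewrite -mulrBl rmorphB.
Qed.

Definition Zinv : Type := {r : rat | r \in Zinv_pred m0 n0}.
HB.instance Definition _ := SubChoice.on Zinv.
HB.instance Definition _ := GRing.SubChoice_isSubZmodule.Build rat
  (fun r => r \in Zinv_pred m0 n0) Zinv Zinv_closed.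

Lemma Zinv_scale_proof (k : int) (r : Zinv) :
  (m%:~R / n%:~R) ^ k * val r \in Zinv_pred m0 n0.
Proof.
have [mQ nQ] := (mQ0, nQ0).
apply/Zinv_predP; have /Zinv_predP[x [p [q ->]]] := valP r.
exists x, (p - k), (q + k).
rewrite expfzMl exprz_inv !expfzDr // -!invr_expz.
by field; rewrite !expfz_neq0.
Qed.

Definition Zinv_group : groupType := Algebra.to_multiplicative Zinv.

Definition Zinv_scale (k : int) (r : Zinv_group) : Zinv_group :=
  exist (fun s => s \in Zinv_pred m0 n0) _ (Zinv_scale_proof k r).

Lemma Zinv_scaleM k (r s : Zinv_group) :
  Zinv_scale k (r * s)%g = (Zinv_scale k r * Zinv_scale k s)%g.
Proof. by apply: val_inj; rewrite /= mulrDr. Qed.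

HB.instance Definition _ (k : int) :=
  isMultiplicative.Build Zinv_group Zinv_group (Zinv_scale k) (Zinv_scaleM k).

Lemma Zinv_scale0 (r : Zinv_group) : Zinv_scale 0 r = r.
Proof. by apply: val_inj; rewrite /= mul1r. Qed.

Lemma Zinv_scaleD (k l : int) (r : Zinv_group) :
  Zinv_scale (k + l) r = Zinv_scale k (Zinv_scale l r).
Proof.
have [mQ nQ] := (mQ0, nQ0).
by apply: val_inj; rewrite /= expfzDr ?mulrA // mulf_neq0 ?invr_eq0.
Qed.

Definition Zinv_action : aut_action Zgroup Zinv_group :=
  @AutAction Zgroup Zinv_group (fun k => Zinv_scale k) Zinv_scale0 Zinv_scaleD.

Definition Gmn : groupType := semidirect Zinv_action.

End Gildenhuys.

Definition Gildenhuys_free (G : groupType) : Prop :=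
  forall (m n : int) (m0 : m != 0%R) (n0 : n != 0%R),
    coprimez m n -> (1 < `|m|)%R -> (1 < `|n|)%R ->
    ~ has_subgroup_iso G (Gmn m0 n0).

Section Kernel.
Variables (G Q : groupType) (f : {multiplicative G -> Q}).

Definition ker : {pred G} := fun x => f x == 1.

Lemma ker_group_closed : group_closed ker.
Proof.
split=> [|x y]; rewrite !unfold_in /ker; first by rewrite hom1.
move=> /eqP fx /eqP fy; rewrite gmulfM fx mul1g.
by rewrite -[f _]mul1g -[X in X * _]fy -gmulfM mulgV hom1.
Qed.

HB.instance Definition _ := isMulClosed.Build G ker
  (group_closedM ker_group_closed).
HB.instance Definition _ := isMul1Closed.Build G ker ker_group_closed.1.
HB.instance Definition _ := isInvClosed.Build G ker
  (group_closedV ker_group_closed).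

End Kernel.

Definition Adian_extension (E : groupType) : Prop :=
  [/\ finitely_generated E, torsion_free E
    & exists (Q : groupType) (f : {multiplicative E -> Q}),
        [/\ infinite_set [set: Q], torsion_group Q, (forall y, exists x, f x = y)
          & cyclic_group (subgroup (ker f : groupClosed E))]].

Definition Adian_free (G : groupType) : Prop :=
  forall H : groupClosed G, ~ Adian_extension (subgroup H).

(* Main.v *)
Require Import Defs.
From HB Require Import structures.
From mathcomp Require Import all_boot all_order all_algebra.
From mathcomp Require Import ring zify.
From mathcomp Require Import generic_quotient boolp classical_sets cardinality.
From mathcomp Require Import fsbigop.

(** The theorem holds because each of the two conditions defining algebraic
    hyperbolicity is, for torsion-free groups, a statement about commensurable
    elements: x and y are commensurable when x^p = y^q with p and q non-zero.

    Suppose that [G] is algebraically hyperbolic and that a <> 1. By commutative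
    transitivity the elements having a non-zero power in <a> form a torsion-free
    abelian group A of rank one, hence a locally cyclic one
    ([isolator_subgroup], [isolator_rank_one], [rank_one_locally_cyclic]). If
    t^-1 a^m t = a^n with m, n non-zero, then t normalises A; were no power t^k
    (k <> 0) in A, conjugation by t would make A x| <t> a forbidden subgroup. So
    some power of t equals a power of a ([AH_conjugate_powers]). The generators
    of BS(m,n) and of G_{m,n} satisfy that relation but have no such powers in
    common, as is seen in the affine group G_{m,n}, to which BS(m,n) maps. In
    an Adian extension every element has a power in the cyclic kernel <z>, so it
    is contained in the group A of a = z; being finitely generated it is cyclic,
    and its quotient, a cyclic torsion group, is finite ([AH_Adian_free]).

    Conversely, let [G] be torsion-free and free of the three families.
    - Commutative transitivity: non-trivial commuting elements are
      commensurable, otherwise they would generate Z^2 = BS(1,1). If non-trivial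
      g and k both commute with h <> 1, then a non-trivial power z of h is a
      power of g and of k, it is central in E = <g, k>, and every non-trivial
      element of E, commuting with z, is commensurable with z. Thus E/<z> is a
      torsion group. If it is infinite, E is an Adian extension. If it is
      finite, the transfer E -> <z> is injective and E is abelian
      ([free_commutative_transitive]).
    - Let H x| Z be a subgroup with H locally cyclic, and sigma the automorphism
      given by the generator t of Z. As H has rank one, there are coprime m, n
      with sigma(x)^n = x^m for all x in H ([sigma_ratio]). If m or n is 1 or
      -1, an element of H and t (or its inverse) generate BS(1,mn), by the
      normal form t^i a^j t^-k ([BS1_embeds]). Otherwise Bezout's identity shows
      that H has all roots of order (mn)^N, so H contains a copy of Z[1/mn], on
      which sigma is multiplication by m/n: a Gildenhuys group
      ([ratio_Gmn]). *)

Set Implicit Arguments.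
Unset Strict Implicit.
Unset Printing Implicit Defensive.

Import GRing.Theory Num.Theory.

Local Open Scope quotient_scope.
Local Open Scope group_scope.

(** * Integer powers *)

Definition expgz (G : groupType) (x : G) (k : int) : G :=
  match k with Posz n => x ^+ n | Negz n => x ^- n.+1 end.

Local Notation "x ^^ k" := (expgz x k) (at level 29, left associativity).

Lemma intSr (n : nat) : Posz n.+1 = (Posz n + 1)%R.
Proof. by rewrite -addn1 PoszD. Qed.

Section Powers.
Variable G : groupType.
Implicit Types (x y : G) (k l : int).

Lemma expgzS x k : x ^^ (k + 1)%R = x ^^ k * x.
Proof.
case: k => [n|n].
  by rewrite -[(Posz n + 1)%R]/(Posz (n + 1)) addn1 /= expgSr.
have -> : (Negz n + 1 = - Posz n)%R by lia.
case: n => [|n]; first by rewrite /= mulVg.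
by rewrite -NegzE /= [in RHS]expgS invgM mulgVK.
Qed.

Lemma expgzP x k : x ^^ (k - 1)%R = x ^^ k * x^-1.
Proof. by rewrite -[in RHS](subrK 1%R k) expgzS mulgK. Qed.

Lemma expgzD x k l : x ^^ (k + l)%R = x ^^ k * x ^^ l.
Proof.
elim/int_rect: l => [|n IHn|n IHn]; first by rewrite addr0 mulg1.
  by rewrite intSr addrA !expgzS IHn mulgA.
by rewrite intSr opprD addrA !expgzP IHn mulgA.
Qed.

Lemma expgzN x k : x ^^ (- k)%R = (x ^^ k)^-1.
Proof. by apply: (mulIg (x ^^ k)); rewrite -expgzD addNr mulVg. Qed.

Lemma expgzB x k l : x ^^ (k - l)%R = x ^^ k / x ^^ l.
Proof. by rewrite expgzD expgzN. Qed.

Lemma expg1z k : 1 ^^ k = 1 :> G.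
Proof. by case: k => n /=; rewrite expg1n ?invg1. Qed.

Lemma expgzM x k l : x ^^ (k * l)%R = (x ^^ k) ^^ l.
Proof.
elim/int_rect: l => [|n IHn|n IHn]; first by rewrite mulr0.
  by rewrite intSr expgzS mulrDr mulr1 expgzD IHn.
by rewrite intSr opprD expgzP mulrDr mulrN1 expgzB IHn.
Qed.

Lemma expgzAC x k l : (x ^^ k) ^^ l = (x ^^ l) ^^ k.
Proof. by rewrite -!expgzM mulrC. Qed.

Lemma commuteXz x y k : commute x y -> commute x (y ^^ k).
Proof.
by case: k => n xy; [exact: commuteX | exact/commuteV/commuteX].
Qed.

Lemma commuteXz2 x y k l : commute x y -> commute (x ^^ k) (y ^^ l).
Proof. by move=> xy; apply/commute_sym/commuteXz/commute_sym/commuteXz. Qed.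

Lemma commute_expgz x k l : commute (x ^^ k) (x ^^ l).
Proof. exact: commuteXz2. Qed.

Lemma expgzMn x y k : commute x y -> (x * y) ^^ k = x ^^ k * y ^^ k.
Proof.
move=> xy; case: k => n /=; first exact: expgMn.
rewrite expgMn // invgM.
exact/commute_sym/commuteV/commute_sym/commuteV/commuteX2.
Qed.

Lemma expVgz x k : x^-1 ^^ k = (x ^^ k)^-1.
Proof. by rewrite -[x^-1]/(x ^^ (-1)%R) expgzAC. Qed.

Lemma expgz_conj x y k : y * x ^^ k / y = (y * x / y) ^^ k.
Proof.
have e n : y * x ^+ n / y = (y * x / y) ^+ n.
  elim: n => [|n IHn]; first by rewrite mulg1 mulgV.
  by rewrite !expgS -IHn !mulgA mulgVK.
by case: k => n; rewrite /= -?e // !invgM invgK mulgA.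
Qed.

Lemma expgz_mem (H : groupClosed G) x k : x \in H -> x ^^ k \in H.
Proof. by case: k => n xH /=; [exact: gpredXn | exact: gpredXNn]. Qed.

Hypothesis tfG : torsion_free G.

Lemma expgz_eq1 x k : x ^^ k = 1 -> k != 0%R -> x = 1.
Proof.
case: k => n /= xk k0; first by apply: (tfG (n := n)) => //; lia.
by apply: (tfG (n := n.+1)) => //; apply: invg_inj; rewrite xk invg1.
Qed.

Lemma expgz_inj x k l : x <> 1 -> x ^^ k = x ^^ l -> k = l.
Proof.
move=> x1 xkl; apply/eqP; rewrite -subr_eq0; apply/negPn/negP => kl.
by apply: x1; apply: expgz_eq1 kl; rewrite expgzB xkl mulgV.
Qed.

Lemma expgz_root x y k : commute x y -> x ^^ k = y ^^ k -> k != 0%R -> x = y.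
Proof.
move=> xy xyk k0; apply: divg1_eq; apply: expgz_eq1 k0.
by rewrite expgzMn ?expVgz ?xyk ?mulgV //; exact: commuteV.
Qed.

End Powers.

Lemma homV (G H : groupType) (f : {multiplicative G -> H}) x :
  f x^-1 = (f x)^-1.
Proof. by apply: (mulIg (f x)); rewrite -gmulfM !mulVg hom1. Qed.

Lemma hom_expgz (G H : groupType) (f : {multiplicative G -> H}) x k :
  f (x ^^ k) = f x ^^ k.
Proof.
have fX n y : f (y ^+ n) = f y ^+ n.
  by elim: n => [|n IHn]; rewrite ?hom1 // !expgS gmulfM IHn.
by case: k => n /=; rewrite ?homV fX.
Qed.

Lemma expgz_Zgroup (k l : int) : (k : Zgroup) ^^ l = (k * l)%R.
Proof.
elim/int_rect: l => [|n IHn|n IHn]; first by rewrite mulr0.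
  by rewrite intSr expgzS IHn mulrDr mulr1.
by rewrite intSr opprD expgzP IHn mulrDr mulrN1.
Qed.

(** * Subgroups, embeddings and generation *)

Section PropSubgroup.
Variables (G : groupType) (P : G -> Prop).
Hypotheses (P1 : P 1) (PF : forall x y, P x -> P y -> P (x / y)).

(** The closure proofs are parameters so that the group structure can be
    attached to the predicate itself. *)
Definition prop_pred of P 1 & (forall x y, P x -> P y -> P (x / y)) :
  {pred G} := fun x => `[< P x >].

Lemma prop_pred_closed : group_closed (prop_pred P1 PF).
Proof.
split=> [|x y /asboolP Px /asboolP Py]; apply/asboolP => //; exact: PF.
Qed.

HB.instance Definition _ := isMulClosed.Build G (prop_pred P1 PF)
  (group_closedM prop_pred_closed).
HB.instance Definition _ :=
  isMul1Closed.Build G (prop_pred P1 PF) prop_pred_closed.1.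
HB.instance Definition _ := isInvClosed.Build G (prop_pred P1 PF)
  (group_closedV prop_pred_closed).

Lemma subgroup_of_prop : exists H : groupClosed G, forall x, x \in H <-> P x.
Proof.
exists (prop_pred P1 PF : groupClosed G) => x.
by split=> [/asboolP | Px]; last exact/asboolP.
Qed.

End PropSubgroup.

Lemma multiplicative_of (G H : groupType) (f : G -> H) :
  {morph f : x y / x * y} -> exists g : {multiplicative G -> H}, g =1 f.
Proof.
move=> fM; pose mf := isMultiplicative.Build G H f fM.
by pose g : {multiplicative G -> H} := HB.pack f mf; exists g.
Qed.

Lemma hom_inj (G H : groupType) (f : {multiplicative G -> H}) :
  (forall x, f x = 1 -> x = 1) -> injective f.
Proof.
move=> f1 x y fxy; apply: divg1_eq; apply: f1.
by rewrite gmulfM homV fxy mulgV.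
Qed.

Lemma surj_inj_bij (S T : choiceType) (f : S -> T) :
  injective f -> (forall y, exists x, f x = y) -> bijective f.
Proof.
move=> fI fS; have ex y : exists x, f x == y by have [x <-] := fS y; exists x.
pose g y := xchoose (ex y).
have gK : cancel g f by move=> y; apply/eqP/(xchooseP (ex y)).
by exists g => // x; apply: fI; rewrite gK.
Qed.

Lemma isomorphic_sym (A B : groupType) : isomorphic A B -> isomorphic B A.
Proof.
move=> [f [g fK gK]].
have gM : {morph g : x y / x * y}.
  by move=> x y; rewrite -[RHS]fK gmulfM !gK.
have [h hE] := multiplicative_of gM; exists h; exists f => x; rewrite hE //.
Qed.

(** Embeddings are easier to build and to compose than isomorphisms onto a
    subgroup; conversely, the subgroup is the image of the embedding. *)
Lemma has_subgroup_isoP (G B : groupType) :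
  has_subgroup_iso G B <-> exists f : {multiplicative B -> G}, injective f.
Proof.
split=> [[H /isomorphic_sym[f /bij_inj fI]]|[f fI]].
  have vM : {morph (fun x => val (f x)) : x y / x * y}.
    by move=> x y; rewrite gmulfM.
  have [h hE] := multiplicative_of vM; exists h => x y.
  by rewrite !hE => /val_inj/fI.
have [||H HP] := @subgroup_of_prop G (fun x => exists b, f b = x).
- by exists 1; rewrite hom1.
- by move=> _ _ [b <-] [c <-]; exists (b / c); rewrite gmulfM homV.
exists H; apply: isomorphic_sym.
have fH b : f b \in H by apply/HP; exists b.
pose g b : subgroup H := exist (fun x => x \in H) (f b) (fH b).
have gM : {morph g : x y / x * y}.
  by move=> x y; apply: val_inj; rewrite /= gmulfM.
have [h hE] := multiplicative_of gM; exists h; apply: surj_inj_bij => [x y|y].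
  by rewrite !hE => /(congr1 val)/fI.
have /HP[b fb] := valP y; exists b; rewrite hE; exact: val_inj.
Qed.

Lemma torsion_free_inj (A B : groupType) (f : {multiplicative A -> B}) :
  injective f -> torsion_free B -> torsion_free A.
Proof.
move=> fI tfB x n n0 xn; apply: fI; rewrite hom1; apply: tfB n0 _.
by rewrite -[_ ^+ _]/(f x ^^ n) -hom_expgz [x ^^ n]xn hom1.
Qed.

Lemma generates_cycle (G : groupType) (z x : G) :
  generates [:: z] -> exists k, x = z ^^ k.
Proof.
have [||H HP] := @subgroup_of_prop G (fun x => exists k, x = z ^^ k).
- by exists 0%R.
- by move=> _ _ [k ->] [l ->]; exists (k - l)%R; rewrite expgzB.
move=> gz; apply/HP/gz => y; rewrite inE => /eqP ->.
by apply/HP; exists 1%R.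
Qed.

Lemma generated_subgroup (G : groupType) (s : seq G) :
  exists H : groupClosed G,
    [/\ {subset s <= H}, finitely_generated (subgroup H)
      & forall K : groupClosed G, {subset s <= K} -> {subset H <= K}].
Proof.
have [||H HP] := @subgroup_of_prop G
    (fun x => forall K : groupClosed G, {subset s <= K} -> x \in K).
- by move=> K _; exact: gpred1.
- by move=> x y Hx Hy K sK; apply: gpredF; [exact: Hx | exact: Hy].
have sH : {subset s <= H} by move=> x xs; apply/HP => K; exact.
exists H; split=> //; last by move=> K sK x /HP; exact.
(* A subgroup K of H containing s is pushed forward to a subgroup of G. *)
exists (pmap insub s) => K sK [x xH].
have [||L LP] := @subgroup_of_prop G (fun x => exists2 y, y \in K & val y = x).
- by exists 1; rewrite ?gpred1.
- by move=> _ _ [y Ky <-] [z Kz <-]; exists (y / z); rewrite ?gpredF.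
have /LP[y Ky /= yx] : x \in L.
  move/HP: (xH); apply=> y ys; apply/LP; exists (Sub y (sH y ys)) => //.
  by apply: sK; rewrite mem_pmap_sub SubK.
by rewrite (_ : exist _ _ _ = y) //; exact: val_inj.
Qed.

(** * Torsion-free abelian groups of rank one *)

Definition commutative_group (G : groupType) : Prop :=
  forall x y : G, commute x y.

Definition rank_one (G : groupType) : Prop :=
  forall x y : G, x <> 1 -> exists p q : int, p != 0%R /\ y ^^ p = x ^^ q.

Lemma int_gcd_split (p q : int) : p != 0%R ->
  exists d p' q' u v : int,
    [/\ d != 0, p = p' * d, q = q' * d & u * p' + v * q' = 1]%R.
Proof.
move=> p0; have [u [v uv]] := Bezoutz p q.
have d0 : gcdz p q != 0%R by rewrite gcdz_eq0 (negbTE p0).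
exists (gcdz p q), (p %/ gcdz p q)%Z, (q %/ gcdz p q)%Z, u, v; split=> //.
- by rewrite divzK // dvdz_gcdl.
- by rewrite divzK // dvdz_gcdr.
apply: (mulIf d0); rewrite mulrDl -!mulrA !divzK ?dvdz_gcdl ?dvdz_gcdr //.
by rewrite uv mul1r.
Qed.

(** Euclid's algorithm in the abelian group <x, y>: after dividing p and q by
    their gcd, which torsion-freeness permits, y^p' = x^q' with u p' + v q' = 1,
    and w = x^u y^v is a common root. *)
Lemma common_root (G : groupType) (x y : G) (p q : int) :
  torsion_free G -> commute x y -> p != 0%R -> y ^^ p = x ^^ q ->
  exists w i j, x = w ^^ i /\ y = w ^^ j.
Proof.
move=> tfG xy p0.
have [d [p' [q' [u [v [d0 -> -> uv]]]]]] := int_gcd_split q p0.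
rewrite !expgzM => e.
have yx := expgz_root tfG (commuteXz2 p' q' (commute_sym xy)) e d0.
exists (x ^^ u * y ^^ v), p', q'.
rewrite !expgzMn -?expgzM; try exact: commuteXz2.
split.
  rewrite [(v * _)%R]mulrC [y ^^ _]expgzM yx -expgzM -expgzD.
  by rewrite [(q' * v)%R]mulrC uv.
rewrite [(u * _)%R]mulrC [x ^^ _]expgzM -yx -expgzM -expgzD.
by rewrite [(p' * u)%R]mulrC uv.
Qed.

Section RankOne.
Variable G : groupType.
Hypotheses (tfG : torsion_free G) (cG : commutative_group G).
Hypothesis r1G : rank_one G.

(** Adjoining the generators one at a time, a cyclic group stays cyclic by
    [common_root]. *)
Lemma rank_one_cyclic_seq (s : seq G) :
  exists w, forall x, x \in s -> exists k, x = w ^^ k.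
Proof.
elim: s => [|y s [w ws]]; first by exists 1.
have [w1|/eqP w1] := eqVneq w 1.
  exists y => x; rewrite inE => /orP[/eqP -> | /ws[k ->]]; first by exists 1%R.
  by exists 0%R; rewrite w1 expg1z.
have [p [q [p0 ypq]]] := r1G y w1.
have [v [i [j [wv yv]]]] := common_root tfG (cG w y) p0 ypq.
exists v => x; rewrite inE => /orP[/eqP -> | /ws[k ->]]; first by exists j.
by exists (i * k)%R; rewrite wv expgzM.
Qed.

Lemma rank_one_fg_cyclic :
  finitely_generated G -> exists w : G, forall x, exists k, x = w ^^ k.
Proof.
move=> [s gs]; have [w ws] := rank_one_cyclic_seq s; exists w.
have [||H HP] := @subgroup_of_prop G (fun x => exists k, x = w ^^ k).
- by exists 0%R.
- by move=> _ _ [k ->] [l ->]; exists (k - l)%R; rewrite expgzB.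
by move=> x; apply/HP/gs => y /ws ?; apply/HP.
Qed.

Lemma rank_one_fg_Z :
  finitely_generated G -> nontrivial G -> isomorphic G Zgroup.
Proof.
move=> /rank_one_fg_cyclic[w wG] [x x1].
have w1 : w <> 1 by move=> w1; have [k xk] := wG x; rewrite w1 expg1z in xk.
apply: isomorphic_sym.
have [f fE] := @multiplicative_of Zgroup G (fun k => w ^^ k) (expgzD w).
exists f; apply: surj_inj_bij => [k l|y]; first by rewrite !fE => /expgz_inj->.
by have [k ->] := wG y; exists k; rewrite fE.
Qed.

End RankOne.

Lemma rank_one_inj (A B : groupType) (f : {multiplicative A -> B}) :
  injective f -> rank_one B -> rank_one A.
Proof.
move=> fI r1 x y x1.
have fx1 : f x <> 1 by move=> fx; apply: x1; apply: fI; rewrite fx hom1.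
have [p [q [p0 e]]] := r1 (f x) (f y) fx1.
by exists p, q; split=> //; apply: fI; rewrite !hom_expgz.
Qed.

Lemma rank_one_locally_cyclic (G : groupType) :
  torsion_free G -> commutative_group G -> rank_one G -> locally_cyclic G.
Proof.
move=> tfG cG r1G K; pose v : {multiplicative subgroup K -> G} := val.
have vI : injective v by exact: val_inj.
apply: rank_one_fg_Z; first exact: torsion_free_inj vI tfG.
  by move=> x y; apply: vI; rewrite !gmulfM; exact: cG.
exact: rank_one_inj vI r1G.
Qed.

(** This is the only consequence of local cyclicity used for H x| Z: two
    elements always lie in a common cyclic subgroup. *)
Lemma locally_cyclic_pair (G : groupType) (x y : G) : locally_cyclic G ->
  exists w i j, x = w ^^ i /\ y = w ^^ j.
Proof.
move=> lcG; have [K [sK fgK _]] := generated_subgroup [:: x; y].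
have [nt|triv] := pselect (nontrivial (subgroup K)); last first.
  have K1 z : z \in K -> z = 1.
    move=> zK; apply: contrapT => z1; apply: triv.
    by exists (Sub z zK) => /(congr1 val).
  exists 1, 0%R, 0%R; split; apply: K1; apply: sK; rewrite !inE eqxx ?orbT //.
have /isomorphic_sym[f [g fK gK]] := lcG K fgK nt.
have kE z (zK : z \in K) : z = val (f (1%R : int)) ^^ (g (Sub z zK)).
  rewrite -[X in X ^^ _]/((val : {multiplicative subgroup K -> G}) (f 1%R)).
  by rewrite -hom_expgz -hom_expgz expgz_Zgroup mul1r gK.
have [xK yK] : x \in K /\ y \in K by split; apply: sK; rewrite !inE eqxx ?orbT.
by exists (val (f (1%R : int))), (g (Sub x xK)), (g (Sub y yK)).
Qed.

(** * Homomorphisms from semidirect products and from presented groups *)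

Section SemidirectTheory.
Variables (H K : groupType) (phi : aut_action K H).

Lemma sd_mulE (x y : semidirect phi) :
  x * y = (x.1 * autact phi x.2 y.1, x.2 * y.2) :> semidirect phi.
Proof. by []. Qed.

Definition sd_inl (h : H) : semidirect phi := (h, 1).

Lemma sd_inlM : {morph sd_inl : x y / x * y}.
Proof.
by move=> x y; rewrite sd_mulE /= autact1 mul1g.
Qed.

HB.instance Definition _ :=
  isMultiplicative.Build H (semidirect phi) sd_inl sd_inlM.

Lemma sd_inl_inj : injective sd_inl.
Proof. by move=> x y []. Qed.

Definition sd_proj (x : semidirect phi) : K := x.2.

Lemma sd_projM : {morph sd_proj : x y / x * y}.
Proof. by []. Qed.

HB.instance Definition _ :=
  isMultiplicative.Build (semidirect phi) K sd_proj sd_projM.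

Definition sd_inr (k : K) : semidirect phi := (1, k).

Lemma sd_inr_conj k h :
  sd_inr k * sd_inl h / sd_inr k = sd_inl (autact phi k h).
Proof.
apply: (mulIg (sd_inr k)); rewrite mulgVK !sd_mulE /=.
by rewrite hom1 !gsimp.
Qed.

End SemidirectTheory.

Section SemidirectLift.
Variables (H G : groupType) (phi : aut_action Zgroup H).
Variables (i : {multiplicative H -> G}) (t : G).
Hypothesis it : forall h, t * i h / t = i (autact phi (1%R : int) h).

Lemma sd_lift_conj (k : int) h : t ^^ k * i h = i (autact phi k h) * t ^^ k.
Proof.
have it' g : t^-1 * i g * t = i (autact phi (- 1 : int)%R g).
  rewrite -[in LHS](autact1 phi g) -[1 : Zgroup]/((1 + - 1)%R : int).
  rewrite (autactM phi (1%R : int) (- 1 : int)%R) -it.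
  by rewrite !mulgA mulVg mul1g mulgVK.
elim/int_rect: k h => [|n IHn|n IHn] h; first by rewrite autact1 mul1g mulg1.
  rewrite intSr expgzS -mulgA (_ : t * i h = i (autact phi (1%R : int) h) * t).
    by rewrite mulgA IHn -autactM mulgA.
  by rewrite -it mulgVK.
rewrite intSr opprD expgzP -mulgA.
rewrite (_ : t^-1 * i h = i (autact phi (- 1 : int)%R h) * t^-1).
  by rewrite mulgA IHn -autactM mulgA.
by rewrite -it' mulgK.
Qed.

Lemma sd_lift : exists f : {multiplicative semidirect phi -> G},
  forall x, f x = i x.1 * t ^^ x.2.
Proof.
apply: multiplicative_of => -[h k] [g l] /=.
rewrite gmulfM (expgzD t k l) !mulgA.
by rewrite -(mulgA (i h) (t ^^ k)) sd_lift_conj !mulgA.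
Qed.

(** The kernel of the induced map is trivial as soon as the image of H meets
    <t> trivially, since i h * t^k = 1 says that i h = t^-k. *)
Lemma sd_embeds :
    injective i -> (forall h (k : int), i h = t ^^ k -> k = 0%R) ->
  has_subgroup_iso G (semidirect phi).
Proof.
move=> iI it0; apply/has_subgroup_isoP; have [f fE] := sd_lift.
exists f; apply: hom_inj => -[h k]; rewrite fE /= => e.
have k0 : k = 0%R.
  apply/oppr_inj; rewrite oppr0; apply: (it0 h).
  by rewrite expgzN; apply: (mulIg (t ^^ k)); rewrite e mulVg.
rewrite k0 mulg1 in e *; congr (_, _); apply: iI; by rewrite e hom1.
Qed.

End SemidirectLift.

Section Presented.
Variables (X : choiceType) (R : seq (X * bool) -> seq (X * bool) -> Prop).

Definition word_eval (G : groupType) (s : X -> G) (u : seq (X * bool)) : G :=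
  \prod_(l <- u) if l.2 then (s l.1)^-1 else s l.1.

Lemma word_eval_cons (G : groupType) (s : X -> G) l u :
  word_eval s (l :: u) = (if l.2 then (s l.1)^-1 else s l.1) * word_eval s u.
Proof. exact: big_cons. Qed.

Lemma word_eval_cat (G : groupType) (s : X -> G) u v :
  word_eval s (u ++ v) = word_eval s u * word_eval s v.
Proof. exact: big_cat. Qed.

Lemma word_eval_pow (G : groupType) (s : X -> G) x k :
  word_eval s (word_pow x k) = s x ^^ k.
Proof.
have e n b : word_eval s (nseq n (x, b)) = (if b then (s x)^-1 else s x) ^+ n.
  by elim: n => [|n IHn]; rewrite ?[LHS]big_nil // word_eval_cons IHn expgS.
by case: k => n; rewrite /word_pow e // expVgn.
Qed.

Lemma presented_lift (G : groupType) (s : X -> G) :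
    (forall u v, R u v -> word_eval s u = word_eval s v) ->
  exists f : {multiplicative presented R -> G},
    forall u, f (\pi_(presented R) u) = word_eval s u.
Proof.
move=> sR.
have sE u v : word_eq R u v -> word_eval s u = word_eval s v.
  elim=> {u v} // [u v w _ -> _ -> //|u u' v v' _ eu _ ev|x b].
    by rewrite !word_eval_cat eu ev.
  rewrite !word_eval_cons [word_eval s [::]]big_nil mulg1.
  by case: b; rewrite /= ?mulVg ?mulgV.
have rE u : word_eval s (repr (\pi_(presented R) u)) = word_eval s u.
  exact/sE/repr_word.
have [|f fE] :=
  @multiplicative_of (presented R) G (fun p => word_eval s (repr p)).
  by move=> p q; rewrite [LHS]rE word_eval_cat.
by exists f => u; rewrite fE rE.
Qed.

Definition pres_gen (x : X) : presented R := \pi_(presented R) [:: (x, false)].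

Lemma pi_word_eval u : \pi_(presented R) u = word_eval pres_gen u.
Proof.
elim: u => [|[x b] u IHu]; first by rewrite [RHS]big_nil.
rewrite word_eval_cons -IHu.
have piM v w : \pi_(presented R) (v ++ w) =
    \pi_(presented R) v * \pi_(presented R) w.
  by apply/esym/pi_word/WordCat; exact: repr_word.
rewrite -cat1s piM; congr (_ * _); case: b => //=.
apply/esym/mulg1_eq; rewrite /pres_gen -piM; apply: pi_word.
exact: (WordCancel _ _ false).
Qed.

Lemma pres_eval (p : presented R) : p = word_eval pres_gen (repr p).
Proof. by rewrite -pi_word_eval reprK. Qed.

Lemma pres_rel u v : R u v -> word_eval pres_gen u = word_eval pres_gen v.
Proof. by move=> uv; rewrite -!pi_word_eval; exact/pi_word/WordRel. Qed.

End Presented.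

(** * The groups BS(m,n) and G_{m,n} *)

Section BaumslagSolitar.
Variables (m n : int).

Definition BS_a : BS m n := pres_gen (BS_rel m n) false.
Definition BS_t : BS m n := pres_gen (BS_rel m n) true.

Definition BS_gens (G : groupType) (a t : G) (x : bool) : G :=
  if x then t else a.

Lemma word_eval_BS_rel (G : groupType) (s : bool -> G) u v : BS_rel m n u v ->
  word_eval s u = (s true)^-1 * s false ^^ m * s true /\
  word_eval s v = s false ^^ n.
Proof.
move=> [-> ->]; rewrite !word_eval_cat !word_eval_pow; split=> //.
exact: mulgA.
Qed.

Lemma BS_relation : BS_t^-1 * BS_a ^^ m * BS_t = BS_a ^^ n.
Proof.
set u := word_pow true (-1)%R ++ word_pow false m ++ word_pow true 1%R.
have uv : BS_rel m n u (word_pow false n) by [].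
have [<- <-] := word_eval_BS_rel (pres_gen (BS_rel m n)) uv.
exact: pres_rel.
Qed.

Lemma BS_lift (G : groupType) (a t : G) : t^-1 * a ^^ m * t = a ^^ n ->
  exists f : {multiplicative BS m n -> G},
    forall u, f (\pi_(BS m n) u) = word_eval (BS_gens a t) u.
Proof.
move=> at_; apply: presented_lift => u v uv.
have [e1 e2] := word_eval_BS_rel (BS_gens a t) uv.
exact: etrans e1 (etrans at_ (esym e2)).
Qed.

End BaumslagSolitar.

(** The relation a t = t a^n moves positive powers of t to the left, and
    t^-1 a = a^n t^-1 moves negative ones to the right. *)
Lemma BS1_normal_form (G : groupType) (a t : G) (n : int) u :
  t^-1 * a * t = a ^^ n ->
  exists (i k : nat) (j : int),
    word_eval (BS_gens a t) u = t ^+ i * a ^^ j * t ^- k.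
Proof.
move=> at_; have tV j : t^-1 * a ^^ j = a ^^ (n * j)%R * t^-1.
  have := expgz_conj a t^-1 j; rewrite invgK at_ -expgzM => <-.
  by rewrite mulgK.
have tX j i : exists j', a ^^ j * t ^+ i = t ^+ i * a ^^ j'.
  elim: i j => [|i IHi] j; first by exists j; rewrite mulg1 mul1g.
  have [j' e] := IHi (n * j)%R; exists j'; rewrite !expgS -!mulgA -e.
  by apply: (mulgI t^-1); rewrite mulKg !mulgA tV mulgVK.
elim: u => [|[x b] u [i [k [j IHu]]]].
  by exists 0, 0, 0%R; rewrite [LHS]big_nil invg1 !mulg1.
rewrite word_eval_cons IHu /= {IHu}; case: x => /=.
  case: b; last by exists i.+1, k, j; rewrite expgS !mulgA.
  case: i => [|i]; last by exists i, k, j; rewrite expgS !mulgA mulVg mul1g.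
  by exists 0, k.+1, (n * j)%R; rewrite !mul1g mulgA tV expgSr invgM !mulgA.
have -> : (if b then a^-1 else a) = a ^^ (if b then -1 else 1)%R by case: b.
set e := (if b then _ else _); have [j' ej] := tX e i.
by exists i, k, (j' + j)%R; rewrite !mulgA ej expgzD !mulgA.
Qed.

(** A relation t^i a^j t^-k = 1 in G reads a^j = t^(k-i), so it forces
    j = 0 and i = k and already holds in BS(1,n). *)
Lemma BS1_embeds (G : groupType) (a t : G) (n : int) :
    t^-1 * a * t = a ^^ n ->
    (forall j k, a ^^ j = t ^^ k -> j = 0%R /\ k = 0%R) ->
  has_subgroup_iso G (BS 1 n).
Proof.
move=> at_ at0; apply/has_subgroup_isoP; have [f fE] := @BS_lift 1 n G a t at_.
exists f; apply: hom_inj => p.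
have [i [k [j e]]] := @BS1_normal_form _ _ _ n (repr p) (@BS_relation 1 n).
have [fa ft] : f (BS_a 1 n) = a /\ f (BS_t 1 n) = t.
  by rewrite !fE !word_eval_cons [word_eval _ [::]]big_nil !mulg1.
have {e} -> : p = BS_t 1 n ^+ i * BS_a 1 n ^^ j * BS_t 1 n ^- k.
  by rewrite -e [LHS]pres_eval; apply: eq_bigr => -[[]].
rewrite -[BS_t 1 n ^+ i]/(BS_t 1 n ^^ i) -[BS_t 1 n ^+ k]/(BS_t 1 n ^^ k).
rewrite -expgzN 2!gmulfM !hom_expgz fa ft => e.
have [|j0 ki] := at0 j (- Posz i + Posz k)%R.
  apply: (mulgI (t ^^ i)); apply: (mulIg (t ^^ (- Posz k)%R)).
  by rewrite e -!expgzD addrA addrN add0r addrN.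
have -> : i = k by lia.
by rewrite j0 mulg1 -expgzD addrN.
Qed.

Section GildenhuysGroup.
Variables (m n : int) (m0 : m != 0%R) (n0 : n != 0%R).

Lemma Zinv_one_proof : 1%R \in Zinv_pred m0 n0.
Proof.
apply/Zinv_predP; exists 1%R, 0%R, 0%R.
by rewrite !expr0z !(mulr1, invr1).
Qed.

Definition Zinv_one : Zinv_group m0 n0 :=
  exist (fun r => r \in Zinv_pred m0 n0) 1%R Zinv_one_proof.

Lemma val_Zinv_expgz (x : Zinv_group m0 n0) k :
  (val (x ^^ k) : rat) = ((val x : rat) *~ k)%R.
Proof.
elim/int_rect: k => [|k IHk|k IHk] //.
  by rewrite intSr expgzS mulrzDr -IHk.
by rewrite intSr opprD expgzP mulrzBr -IHk.
Qed.

Definition Gmn_a : Gmn m0 n0 := sd_inl (Zinv_action m0 n0) Zinv_one.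
Definition Gmn_t : Gmn m0 n0 := sd_inr (Zinv_action m0 n0) (1%R : int).

Lemma Gmn_relation : Gmn_t^-1 * Gmn_a ^^ m * Gmn_t = Gmn_a ^^ n.
Proof.
apply: (mulgI Gmn_t); apply: (mulIg Gmn_t^-1); rewrite !mulgA mulgV mul1g mulgK.
rewrite -!hom_expgz sd_inr_conj; congr (sd_inl _ _); apply: val_inj.
rewrite /= !val_Zinv_expgz /=.
rewrite expr1z divfK ?intr_eq0 //.
Qed.

Lemma Gmn_a_neq1 : Gmn_a <> 1.
Proof. by move=> /sd_inl_inj/(congr1 val)/eqP; rewrite oner_eq0. Qed.

Lemma Gmn_at k l : Gmn_a ^^ k = Gmn_t ^^ l -> l = 0%R.
Proof.
move=> /(congr1 (@sd_proj _ _ (Zinv_action m0 n0))).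
by rewrite !hom_expgz expg1z expgz_Zgroup mul1r => <-.
Qed.

End GildenhuysGroup.

(** * Algebraically hyperbolic groups exclude the three families *)

Lemma transitive_commute (G : groupType) (g h k : G) :
    commutative_transitive G -> h <> 1 -> commute g h -> commute h k ->
  commute g k.
Proof.
move=> ctG h1 gh hk.
have [->|/eqP g1] := eqVneq g 1; first exact/commute_sym/commute1.
have [->|/eqP k1] := eqVneq k 1; first exact: commute1.
by apply/commgP/eqP; apply: ctG h1 _ _ _ => //; apply/eqP/commgP.
Qed.

Lemma conj_action (G : groupType) (H : groupClosed G) (t : G) :
    (forall x, x \in H -> t * x / t \in H) ->
    (forall x, x \in H -> t^-1 * x * t \in H) ->
  exists phi : aut_action Zgroup (subgroup H),
    forall k h, val (autact phi k h) = t ^^ k * val h / t ^^ k.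
Proof.
move=> tH tVH.
have conjH (k : Zgroup) x : x \in H -> t ^^ k * x / t ^^ k \in H.
  elim/int_rect: k x => [|k IHk|k IHk] x xH; first by rewrite mul1g divg1.
    by have := IHk _ (tH _ xH); rewrite intSr expgzS invgM !mulgA.
  by have := IHk _ (tVH _ xH); rewrite intSr opprD expgzP invgM invgK !mulgA.
pose F (k : Zgroup) (h : subgroup H) : subgroup H :=
  exist (fun x => x \in H) _ (conjH k _ (valP h)).
have FM k : {morph F k : x y / x * y}.
  by move=> x y; apply: val_inj; rewrite /= !mulgA mulgVK.
pose Fm k : {multiplicative subgroup H -> subgroup H} :=
  HB.pack (F k) (isMultiplicative.Build _ _ (F k) (FM k)).
have F1 h : Fm 1 h = h by apply: val_inj; rewrite /= mul1g divg1.
have FA k l h : Fm (k * l) h = Fm k (Fm l h).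
  by apply: val_inj; rewrite /= (expgzD t k l) invgM !mulgA.
by exists (AutAction F1 FA).
Qed.

Section Isolator.
Variables (G : groupType) (a : G).
Hypotheses (tfG : torsion_free G) (ctG : commutative_transitive G).
Hypothesis a1 : a <> 1.

(** x commutes with x^p = a^q, which commutes with a. *)
Lemma root_commute (x : G) (p q : int) :
  p != 0%R -> x ^^ p = a ^^ q -> commute x a.
Proof.
move=> p0 e; have [->|/eqP x1] := eqVneq x 1; first exact/commute_sym/commute1.
apply: (transitive_commute (h := x ^^ p)) => //.
- by move=> xp; apply/x1/(expgz_eq1 tfG xp p0).
- exact/commuteXz.
- by rewrite e; exact/commute_sym/commuteXz.
Qed.

(** The roots of powers of a all commute with a, hence with one another, so that
    powers of a product can be computed factorwise. *)
Lemma isolator_subgroup : exists H : groupClosed G,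
  forall x, x \in H <-> exists p q : int, p != 0%R /\ x ^^ p = a ^^ q.
Proof.
apply: subgroup_of_prop => [|x y [p [q [p0 xp]]] [r [s [r0 ys]]]].
  by exists 1%R, 0%R.
exists (p * r)%R, (q * r - s * p)%R; split; first by rewrite mulf_neq0.
have xy : commute x y.
  apply: (transitive_commute (h := a)) => //; first exact: root_commute xp.
  exact/commute_sym/(root_commute r0 ys).
rewrite expgzMn ?expVgz; last exact/commuteV.
by rewrite expgzB !expgzM xp (expgzAC y) ys.
Qed.

End Isolator.

Lemma isolator_rank_one (G : groupType) (a : G) (H : groupClosed G) :
    torsion_free G -> commutative_transitive G -> a <> 1 ->
    (forall x, x \in H -> exists p q : int, p != 0%R /\ x ^^ p = a ^^ q) ->
  commutative_group (subgroup H) /\ rank_one (subgroup H).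
Proof.
move=> tfG ctG a1 HP; pose v : {multiplicative subgroup H -> G} := val.
have vI : injective v by exact: val_inj.
split=> [x y|x y x1]; have /HP[p [q [p0 xp]]] := valP x;
    have /HP[r [s [r0 ys]]] := valP y.
  apply: vI; rewrite !gmulfM; apply: (transitive_commute (h := a)) => //.
    exact: root_commute xp.
  exact/commute_sym/(root_commute tfG ctG r0 ys).
exists (r * q)%R, (s * p)%R; split.
  rewrite mulf_neq0 //; apply/eqP => q0; apply: x1; apply: vI.
  by rewrite hom1; apply: (expgz_eq1 tfG _ p0); rewrite xp q0.
apply: vI; rewrite !hom_expgz expgzM [v y ^^ r]ys -expgzM.
by rewrite [(s * p)%R]mulrC [v x ^^ _]expgzM [v x ^^ p]xp -expgzM mulrC.
Qed.

(** Both t and its inverse normalise the isolator H of <a>: if x^p = a^q, then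
    (t x t^-1)^(pn) = a^(mq). A locally cyclic H normalised by t with
    H meeting <t> trivially would give the forbidden H x| <t>. *)
Lemma AH_conjugate_powers (G : groupType) (a t : G) (m n : int) :
    algebraically_hyperbolic G -> a <> 1 -> m != 0%R -> n != 0%R ->
    t^-1 * a ^^ m * t = a ^^ n ->
  exists k q : int, k != 0%R /\ t ^^ k = a ^^ q.
Proof.
move=> [tfG ctG AHG] a1 m0 n0 e; apply: contrapT => nex; apply: AHG.
have [H HP] := isolator_subgroup tfG ctG a1.
have HP' x : x \in H -> exists p q : int, p != 0%R /\ x ^^ p = a ^^ q.
  by move/HP.
have [cH r1H] := isolator_rank_one tfG ctG a1 HP'.
have e' : t * a ^^ n / t = a ^^ m by rewrite -e !mulgA mulgV mul1g mulgK.
have [||phi phiE] := @conj_action G H t.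
- move=> x /HP[p [q [p0 xp]]]; apply/HP; exists (p * n)%R, (m * q)%R.
  rewrite mulf_neq0 // -expgz_conj expgzM xp expgzAC.
  by rewrite expgz_conj e' expgzM.
- move=> x /HP[p [q [p0 xp]]]; apply/HP; exists (p * m)%R, (n * q)%R.
  rewrite mulf_neq0 // -[X in _ * X]invgK -expgz_conj expgzM xp expgzAC.
  by rewrite expgz_conj invgK e expgzM.
pose v : {multiplicative subgroup H -> G} := val.
exists (subgroup H), phi; split.
- have aH : a \in H by apply/HP; exists 1%R, 1%R.
  by exists (Sub a aH) => /(congr1 val).
- apply: rank_one_locally_cyclic => //.
  by apply: (torsion_free_inj (f := v)) tfG; exact: val_inj.
apply: (@sd_embeds _ _ _ v t) => [h||h k hk].
- exact: (esym (phiE (1%R : int) h)).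
- exact: val_inj.
apply/eqP/negPn/negP => k0; apply: nex.
have /HP[p [q [p0 hp]]] := valP h.
by exists (k * p)%R, q; rewrite mulf_neq0 // expgzM -hk.
Qed.

(** This treats BS(m,n) and G_{m,n} together. The map g to the affine group
    G_{m,n} certifies that a is non-trivial and that no power of t other than 1
    is a power of a; in G_{m,n} itself it is the identity. *)
Lemma AH_no_affine_pair (G P : groupType) (f : {multiplicative P -> G})
    (m n : int) (m0 : m != 0%R) (n0 : n != 0%R)
    (g : {multiplicative P -> Gmn m0 n0}) (a t : P) :
    algebraically_hyperbolic G -> injective f ->
    t^-1 * a ^^ m * t = a ^^ n -> g a = Gmn_a m0 n0 -> g t = Gmn_t m0 n0 ->
  False.
Proof.
move=> AHG fI rel ga gt.
have fa1 : f a <> 1.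
  move=> fa; apply: (@Gmn_a_neq1 m n m0 n0); rewrite -ga.
  by rewrite (fI a 1) ?hom1.
have frel : (f t)^-1 * f a ^^ m * f t = f a ^^ n.
  by rewrite -homV -!hom_expgz -!gmulfM rel.
have [k [q [k0]]] := AH_conjugate_powers AHG fa1 m0 n0 frel.
rewrite -!hom_expgz => /fI/(congr1 g).
rewrite !hom_expgz ga gt => /esym/Gmn_at k00.
by rewrite k00 in k0.
Qed.

Lemma AH_BS_free (G : groupType) : algebraically_hyperbolic G -> BS_free G.
Proof.
move=> AHG m n m0 n0 /has_subgroup_isoP[f fI].
have [g gE] := BS_lift (Gmn_relation m0 n0).
apply: (AH_no_affine_pair (g := g) AHG fI (BS_relation m n)).
  by rewrite gE word_eval_cons [word_eval _ _]big_nil mulg1.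
by rewrite gE word_eval_cons [word_eval _ _]big_nil mulg1.
Qed.

Lemma AH_Gildenhuys_free (G : groupType) :
  algebraically_hyperbolic G -> Gildenhuys_free G.
Proof.
move=> AHG m n m0 n0 _ _ _ /has_subgroup_isoP[f fI].
by apply: (AH_no_affine_pair (g := idfun) AHG fI (Gmn_relation m0 n0)).
Qed.

Lemma mem_subgroup (G : groupType) (H : groupClosed G) x :
  x \in H -> exists y : subgroup H, val y = x.
Proof. by move=> xH; exists (Sub x xH). Qed.

(** For z generating the kernel. It is non-trivial because the extension would
    otherwise be a torsion group, hence trivial, and so would its infinite
    quotient. *)
Lemma Adian_extension_root (E : groupType) : Adian_extension E ->
  exists z : E, [/\ z <> 1,
      forall g, exists p q : int, p != 0%R /\ g ^^ p = z ^^ q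
    & exists (Q : groupType) (f : {multiplicative E -> Q}),
       [/\ infinite_set [set: Q], torsion_group Q
          & forall y, exists x, f x = y]].
Proof.
move=> [_ tfE [Q [f [infQ torQ fS [z gz]]]]].
have zE g : exists (p q : int), p != 0%R /\ g ^^ p = val z ^^ q.
  have [n n0 fgn] := torQ (f g).
  have gK : g ^+ n \in (ker f : groupClosed E).
    by rewrite unfold_in /= /ker -[g ^+ n]/(g ^^ n) hom_expgz [_ ^^ _]fgn.
  have [gk gkE] := mem_subgroup gK.
  have [q gq] := generates_cycle gk gz.
  exists n, q; split; first by lia.
  pose v : {multiplicative subgroup (ker f : groupClosed E) -> E} := val.
  have := congr1 v gq.
  by rewrite hom_expgz => <-; exact: esym gkE.
exists (val z); split=> //; last by exists Q, f.
move=> z1; apply: infQ; apply: (sub_finite_set _ (finite_set1 (1 : Q))).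
move=> y _ /=; have [x <-] := fS y.
have [p [q [p0]]] := zE x; rewrite z1 expg1z => xp.
by rewrite (expgz_eq1 tfE xp p0) hom1.
Qed.

Lemma torsion_cycle_finite (Q : groupType) (w : Q) : torsion_group Q ->
  (forall x, exists k, x = w ^^ k) -> finite_set [set: Q].
Proof.
move=> torQ wQ; have [N N0 wN] := torQ w.
apply: (@sub_finite_set _ _ ((fun i => w ^+ i) @` `I_N)%classic).
  move=> x _; have [k ->] := wQ x; exists `|(k %% N)%Z|%N => /=.
    by have := ltz_pmod k (_ : 0 < N%:Z)%R; lia.
  rewrite [in RHS](divz_eq k N) expgzD mulrC expgzM [w ^^ N]wN expg1z mul1g.
  by rewrite -[LHS]/(w ^^ (Posz `|(k %% N)%Z|%N)) gez0_abs // modz_ge0; lia.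
exact/finite_image/finite_II.
Qed.

(** The extension lies in the isolator of <z>, so it is cyclic, and then so is
    its infinite torsion quotient. *)
Lemma AH_Adian_free (G : groupType) :
  algebraically_hyperbolic G -> Adian_free G.
Proof.
move=> [tfG ctG _] H AE; have [fgE tfE _] := AE.
have [z [z1 zroot [Q [f [infQ torQ fS]]]]] := Adian_extension_root AE.
pose v : {multiplicative subgroup H -> G} := val.
have vz1 : val z <> 1 by move=> vz; apply/z1/val_inj.
have [|cE r1E] := isolator_rank_one (H := H) tfG ctG vz1.
  move=> x xH; have [p [q [p0 e]]] := zroot (Sub x xH).
  by exists p, q; split=> //; have := congr1 v e; rewrite !hom_expgz.
have [w wE] := rank_one_fg_cyclic tfE cE r1E fgE.
apply: infQ; apply: (@torsion_cycle_finite Q (f w)) => // y.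
by have [x <-] := fS y; have [k ->] := wE x; exists k; rewrite hom_expgz.
Qed.

(** * Quotients and the transfer homomorphism *)

Definition normal_pred (G : groupType) (N : groupClosed G) : Prop :=
  forall x y, x \in N -> x ^ y \in N.

Section Quotient.
Variables (G : groupType) (N : groupClosed G) (nN : normal_pred N).

Definition coset_rel : rel G := fun x y => x^-1 * y \in N.

Lemma coset_rel_refl : reflexive coset_rel.
Proof. by move=> x; rewrite /coset_rel mulVg gpred1. Qed.

Lemma coset_rel_sym : symmetric coset_rel.
Proof. by move=> x y; rewrite /coset_rel -gpredV invgM invgK. Qed.

Lemma coset_rel_trans : transitive coset_rel.
Proof.
move=> y x z xy yz; have := gpredM _ _ xy yz.
by rewrite mulgA mulgK.
Qed.

Canonical coset_equiv :=
  EquivRel coset_rel coset_rel_refl coset_rel_sym coset_rel_trans.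

Definition quot of normal_pred N : Type := {eq_quot coset_equiv}.
HB.instance Definition _ := Choice.on (quot nN).
HB.instance Definition _ := EqQuotient.on (quot nN).

Local Notation Q := (quot nN).

Lemma quotP x y : \pi_Q x = \pi_Q y <-> x^-1 * y \in N.
Proof. by split=> [/(@eqquotP _ _ Q)|xy]; last exact/(@eqquotP _ _ Q). Qed.

Definition quot_mul (p q : Q) : Q := \pi_Q (repr p * repr q).
Definition quot_inv (p : Q) : Q := \pi_Q (repr p)^-1.

Lemma quot_piM x y : quot_mul (\pi_Q x) (\pi_Q y) = \pi_Q (x * y).
Proof.
have ex z : (repr (\pi_Q z))^-1 * z \in N by apply/quotP; rewrite reprK.
apply/quotP; set a := repr (\pi_Q x); set b := repr (\pi_Q y).
have -> : (a * b)^-1 * (x * y) = (a^-1 * x) ^ b * (b^-1 * y).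
  by rewrite conjgE invgM !mulgA mulgK.
by apply: gpredM; [exact/nN/ex | exact: ex].
Qed.

Lemma quot_piV x : quot_inv (\pi_Q x) = \pi_Q x^-1.
Proof.
apply/quotP; rewrite invgK.
have : (repr (\pi_Q x))^-1 * x \in N by apply/quotP; rewrite reprK.
move=> /(nN (repr (\pi_Q x))^-1); rewrite /conjg invgK !mulgA mulgV mul1g => h.
by rewrite -gpredV invgM invgK.
Qed.

Lemma quot_mulA : associative quot_mul.
Proof.
elim/quotW=> x; elim/quotW=> y; elim/quotW=> z.
by rewrite (quot_piM y z) (quot_piM x _) (quot_piM x y) (quot_piM _ z) mulgA.
Qed.

Lemma quot_mul1g : left_id (\pi_Q 1) quot_mul.
Proof. by elim/quotW=> x; rewrite quot_piM mul1g. Qed.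

Lemma quot_mulg1 : right_id (\pi_Q 1) quot_mul.
Proof. by elim/quotW=> x; rewrite quot_piM mulg1. Qed.

Lemma quot_mulVg : left_inverse (\pi_Q 1) quot_inv quot_mul.
Proof. by elim/quotW=> x; rewrite quot_piV quot_piM mulVg. Qed.

Lemma quot_mulgV : right_inverse (\pi_Q 1) quot_inv quot_mul.
Proof. by elim/quotW=> x; rewrite quot_piV quot_piM mulgV. Qed.

HB.instance Definition _ := isGroup.Build (quot nN)
  quot_mulA quot_mul1g quot_mulg1 quot_mulVg quot_mulgV.

Lemma quotient_map : exists (Q : groupType) (f : {multiplicative G -> Q}),
  (forall y, exists x, f x = y) /\ forall x, f x = 1 <-> x \in N.
Proof.
have [|f fE] := @multiplicative_of G (quot nN) (fun x => \pi_Q x).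
  by move=> x y; rewrite [RHS]quot_piM.
exists (quot nN), f; split=> [|x]; first by elim/quotW => x; exists x.
rewrite fE; split=> [/esym/quotP|xN]; first by rewrite invg1 mul1g.
by apply/esym/quotP; rewrite invg1 mul1g.
Qed.

End Quotient.

Section Transfer.
Local Open Scope classical_set_scope.
Variables (E Q : groupType) (f : {multiplicative E -> Q}) (z : E).
Hypotheses (tfE : torsion_free E) (z1 : z <> 1).
Hypotheses (zC : forall x : E, commute x z).
Hypotheses (fS : forall y, exists x, f x = y) (finQ : finite_set [set: Q]).
Hypothesis (kerf : forall x, f x = 1 <-> exists k, x = z ^^ k).

(** The transfer into <z>. For a section s of f and b in Q, write
    x s(b) = s(f(x) b) z^d(x,b). Then d(xy,b) = d(x,f(y)b) + d(y,b), and summing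
    over b, with the first sum reindexed by b |-> f(y) b, gives a homomorphism
    tau. As d(z,b) = 1, its value at z is the order of Q. *)
Lemma transfer : exists tau : {multiplicative E -> Zgroup}, tau z <> 1.
Proof.
have [s sK] := choice fS.
have dP xb : exists k, xb.1 * s xb.2 = s (f xb.1 * xb.2) * z ^^ k.
  case: xb => x b /=.
  have [k e] : exists k, (s (f x * b))^-1 * (x * s b) = z ^^ k.
    by apply/kerf; rewrite !gmulfM homV !sK mulVg.
  by exists k; rewrite -e mulVKg.
have [d dE] := choice dP.
have dM x y b : d (x * y, b) = (d (x, (f y * b)%g) + d (y, b))%R.
  apply: (expgz_inj tfE z1); apply: (mulgI (s (f (x * y) * b))).
  rewrite -(dE (x * y, b)) /= -mulgA (dE (y, b)) mulgA (dE (x, f y * b)) /=.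
  by rewrite expgzD gmulfM !mulgA.
have fz : f z = 1 by apply/kerf; exists 1%R.
have dz b : d (z, b) = 1%R.
  apply: (expgz_inj tfE z1); apply: (mulgI (s (f z * b))).
  by rewrite -(dE (z, b)) /= fz mul1g zC.
have [|tau tauE] :=
    @multiplicative_of E Zgroup (fun x => (\sum_(b \in [set: Q]) d (x, b))%R).
  move=> x y; under eq_fsbigr do rewrite dM.
  rewrite fsbig_split //; congr (_ + _)%R; apply/esym; apply: reindex_fsbigT.
  exists (fun b => (f y)^-1 * b); [exact: mulKg | exact: mulVKg].
exists tau; rewrite tauE => e.
have d0 b : [set: Q] b -> (0 <= d (z, b))%R by rewrite dz.
by have := pfsumr_eq0 finQ d0 e (i := 1 : Q) I; rewrite dz.
Qed.

End Transfer.

(** The torsion-free case of Schur's theorem. The transfer is injective: if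
    tau x = 0 and x^p = z^q, then q tau(z) = 0, so q = 0 and x^p = 1. *)
Lemma central_finite_index_commutative (E Q : groupType)
    (f : {multiplicative E -> Q}) (z : E) :
    torsion_free E -> z <> 1 -> (forall x : E, commute x z) ->
    (forall y, exists x, f x = y) -> finite_set [set: Q]%classic ->
    (forall x, f x = 1 <-> exists k, x = z ^^ k) ->
    (forall x, exists p q : int, p != 0%R /\ x ^^ p = z ^^ q) ->
  commutative_group E.
Proof.
move=> tfE z1 zC fS finQ kerf rootz.
have [tau tauz] := transfer tfE z1 zC fS finQ kerf.
have tauI : injective tau.
  apply: hom_inj => x tx; have [p [q [p0 e]]] := rootz x.
  apply: (expgz_eq1 tfE _ p0); rewrite e.
  have /eqP := congr1 tau e; rewrite !hom_expgz tx expg1z eq_sym expgz_Zgroup.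
  by rewrite mulf_eq0 => /orP[/eqP/tauz | /eqP ->].
by move=> x y; apply: tauI; rewrite !gmulfM; exact: addrC.
Qed.

(** * Commutative transitivity *)

(** Otherwise h and g are independent commuting elements, generating
    Z^2 = BS(1,1). *)
Lemma no_Z2_commensurable (G : groupType) (g h : G) :
    torsion_free G -> ~ has_subgroup_iso G (BS 1 1) -> commute g h -> h <> 1 ->
  exists p q : int, p != 0%R /\ g ^^ p = h ^^ q.
Proof.
move=> tfG noZ2 gh h1; apply: contrapT => nex; apply: noZ2.
apply: (@BS1_embeds _ h g); first by rewrite -mulgA -gh mulKg.
move=> j k hg; have k0 : k = 0%R.
  by apply/eqP/negPn/negP => k0; apply: nex; exists k, j.
split=> //; apply/eqP/negPn/negP => j0; apply: h1.
by apply: (expgz_eq1 tfG _ j0); rewrite hg k0.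
Qed.

(** The quotient by <z> is a torsion group; if it is infinite, E is an Adian
    extension, and if it is finite, the transfer applies. *)
Lemma central_extension_commutative (E : groupType) (z : E) :
    torsion_free E -> finitely_generated E -> ~ Adian_extension E ->
    z <> 1 -> (forall x : E, commute x z) ->
    (forall x : E, exists p q : int, p != 0%R /\ x ^^ p = z ^^ q) ->
  commutative_group E.
Proof.
move=> tfE fgE nAE z1 zC rootz.
have [||N NP] := @subgroup_of_prop E (fun x => exists k, x = z ^^ k).
- by exists 0%R.
- by move=> _ _ [k ->] [l ->]; exists (k - l)%R; rewrite expgzB.
have nN : normal_pred N.
  move=> x y /NP[k ->]; apply/NP; exists k.
  by rewrite /conjg -(commuteXz k (zC y)) mulKg.
have [Q [f [fS kerf]]] := quotient_map nN.
have kerf' x : f x = 1 <-> exists k, x = z ^^ k by rewrite kerf NP.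
have [finQ|infQ] := pselect (finite_set [set: Q]%classic).
  exact: central_finite_index_commutative finQ kerf' rootz.
case: nAE; split=> //; exists Q, f; split=> //.
  move=> y; have [x <-] := fS y; have [p [q [p0 xp]]] := rootz x.
  have fxp : f x ^^ p = 1 by rewrite -hom_expgz xp; apply/kerf'; exists q.
  case: p p0 {xp} fxp => n p0 /= fxp; first by exists n => //; lia.
  by exists n.+1 => //; apply: invg_inj; rewrite fxp invg1.
have [zk zkE] : exists zk : subgroup (ker f : groupClosed E), val zk = z.
  apply: mem_subgroup; rewrite unfold_in /= /ker.
  by apply/eqP/kerf'; exists 1%R.
exists zk => K zK x; have /kerf'[k xk] : f (val x) = 1 by exact/eqP/(valP x).
rewrite (_ : x = zk ^^ k); first by apply/expgz_mem/zK; rewrite inE.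
apply: val_inj; rewrite xk -zkE.
pose v : {multiplicative subgroup (ker f : groupClosed E) -> E} := val.
exact: esym (hom_expgz v zk k).
Qed.

(** From g^p = h^q and k^r = h^s one gets z = h^(qs) = g^(ps) = k^(rq), a
    non-trivial element of <g, k> commuting with both generators. *)
Lemma free_commutative_transitive (G : groupType) :
  torsion_free G -> BS_free G -> Adian_free G -> commutative_transitive G.
Proof.
move=> tfG BSfG AfG g h k g1 h1 k1 /eqP/commgP gh /eqP/commgP hk.
have noZ2 : ~ has_subgroup_iso G (BS 1 1) by exact: BSfG.
have [p [q [p0 gp]]] := no_Z2_commensurable tfG noZ2 gh h1.
have [r [s [r0 kr]]] := no_Z2_commensurable tfG noZ2 (commute_sym hk) h1.
have nz x i j : x <> 1 -> i != 0%R -> x ^^ i = h ^^ j -> j != 0%R.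
  move=> x1 i0 xi; apply/eqP => j0; apply: x1; apply: (expgz_eq1 tfG _ i0).
  by rewrite xi j0.
pose z := h ^^ (q * s)%R.
have z1 : z <> 1.
  move=> z1; apply/h1/(expgz_eq1 tfG z1).
  by rewrite mulf_neq0 // ?(nz _ _ _ g1 p0 gp) ?(nz _ _ _ k1 r0 kr).
have zg : z = g ^^ (p * s)%R by rewrite /z !expgzM gp.
have zk : z = k ^^ (r * q)%R by rewrite /z mulrC !expgzM kr.
have [E [sE fgE minE]] := generated_subgroup [:: g; k].
have gE : g \in E by apply: sE; rewrite !inE eqxx.
have kE : k \in E by apply: sE; rewrite !inE eqxx orbT.
have [zE zEz] : exists zE : subgroup E, val zE = z.
  by apply: mem_subgroup; rewrite zg expgz_mem.
have [||C CP] := @subgroup_of_prop G (fun x => commute z x).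
- exact: commute1.
- by move=> x y zx zy; apply: commuteM => //; exact: commuteV.
have EC : {subset E <= C}.
  apply: minE => x; rewrite !inE => /orP[] /eqP ->; apply/CP/commute_sym.
    by rewrite zg; exact: commuteXz.
  by rewrite zk; exact: commuteXz.
pose v : {multiplicative subgroup E -> G} := val.
have vI : injective v by exact: val_inj.
have cE : commutative_group (subgroup E).
  apply: (@central_extension_commutative _ zE).
  - exact: torsion_free_inj vI tfG.
  - exact: fgE.
  - exact: AfG.
  - by move=> e; apply: z1; rewrite -zEz e.
  - move=> x; apply: vI; rewrite !gmulfM [v zE]zEz.
    by apply/commute_sym/CP/EC/(valP x).
  move=> x; have /EC/CP/commute_sym xz := valP x.
  have [i [j [i0 e]]] := no_Z2_commensurable tfG noZ2 xz z1.
  exists i, j; split=> //; apply: vI; rewrite !hom_expgz [v zE]zEz; exact: e.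
have [[g' g'E] [k' k'E]] := (mem_subgroup gE, mem_subgroup kE).
apply/eqP/commgP; rewrite /commute -g'E -k'E.
by rewrite -[val g' * val k']/(v g' * v k') -gmulfM cE gmulfM.
Qed.

(** * Extensions of a locally cyclic group by Z *)

Lemma has_subgroup_iso_trans (G P B : groupType) :
  has_subgroup_iso G P -> has_subgroup_iso P B -> has_subgroup_iso G B.
Proof.
move=> /has_subgroup_isoP[f fI] /has_subgroup_isoP[g gI].
by apply/has_subgroup_isoP; exists (f \o g); exact: inj_comp.
Qed.

Section LocallyCyclicByZ.
Variables (H : groupType) (phi : aut_action Zgroup H).
Hypotheses (tfH : torsion_free H) (lcH : locally_cyclic H).

Local Notation sigma := (autact phi (1%R : int)).
Local Notation inl := (sd_inl phi).
Local Notation t := (sd_inr phi (1%R : int)).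

Lemma locally_cyclic_commutative : commutative_group H.
Proof.
move=> x y; have [w [i [j [-> ->]]]] := locally_cyclic_pair x y lcH.
exact: commute_expgz.
Qed.

Lemma sigmaK : cancel (autact phi (- 1 : int)%R) sigma.
Proof.
by move=> x; rewrite -[RHS](autact1 phi) -(autactM phi (1%R : int)).
Qed.

Lemma sigma_inj : injective sigma.
Proof.
apply: (can_inj (g := autact phi (- 1 : int)%R)) => x.
by rewrite -[RHS](autact1 phi) -(autactM phi (- 1 : int)%R (1%R : int)).
Qed.

(** For one a <> 1, write a = w^i and sigma(a) = w^j and let n/m be i/j in
    lowest terms. Any other x is commensurable with a, so extraction of roots
    carries the relation sigma(a)^n = a^m over to x. *)
Lemma sigma_ratio : nontrivial H -> exists m n : int,
  [/\ m != 0, n != 0, coprimez m n & forall x : H, sigma x ^^ n = x ^^ m]%R.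
Proof.
move=> [a a1]; have [w [i [j [aw bw]]]] := locally_cyclic_pair a (sigma a) lcH.
have i0 : i != 0%R by apply/eqP => i0; rewrite i0 in aw.
have b1 : sigma a <> 1.
  by move=> b1; apply/a1/sigma_inj; rewrite b1 hom1.
have j0 : j != 0%R by apply/eqP => j0; rewrite j0 in bw.
have [d [n [m [u [v [d0 idn jdm uv]]]]]] := int_gcd_split j i0.
have n0 : n != 0%R by apply: contraNneq i0 => n0; rewrite idn n0 mul0r.
have m0 : m != 0%R by apply: contraNneq j0 => m0; rewrite jdm m0 mul0r.
exists m, n; split=> // [|x].
  by apply/coprimezP; exists (v, u); rewrite /= addrC.
have ba : sigma a ^^ n = a ^^ m.
  rewrite bw aw idn jdm -!expgzM; congr (_ ^^ _); ring.
have [c [k [l [ac xc]]]] := locally_cyclic_pair a x lcH.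
have k0 : k != 0%R by apply/eqP => k0; rewrite k0 in ac.
apply: (expgz_root tfH _ _ k0); first exact: locally_cyclic_commutative.
have xa : x ^^ k = a ^^ l by rewrite xc ac -!expgzM mulrC.
by rewrite expgzAC -hom_expgz xa hom_expgz expgzAC ba expgzAC -xa expgzAC.
Qed.

Lemma inl_eq_t (h : H) k : inl h = t ^^ k -> k = 0%R.
Proof.
move=> /(congr1 (@sd_proj _ _ phi)).
by rewrite hom_expgz expgz_Zgroup mul1r => <-.
Qed.

(** t' = t serves m = 1 or -1, where the inverse of sigma is an integral power
    map, and t' = t^-1 serves n = 1 or -1, where sigma is one. *)
Lemma sigma_power_BS1 (a : H) (t' : semidirect phi) (l : int) :
    a <> 1 -> (t' = t \/ t' = t^-1) ->
    t'^-1 * inl a * t' = inl (a ^^ l) ->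
  has_subgroup_iso (semidirect phi) (BS 1 l).
Proof.
move=> a1 tt at_; apply: (@BS1_embeds _ (inl a) t') => [|j k].
  by rewrite at_ hom_expgz.
rewrite -hom_expgz => e; have k0 : k = 0%R.
  case: tt e => ->; first exact: inl_eq_t.
  by rewrite expVgz -expgzN => /inl_eq_t/eqP; rewrite oppr_eq0 => /eqP.
split=> //; apply/eqP/negPn/negP => j0; apply: a1.
by apply: (expgz_eq1 tfH _ j0); apply: (@sd_inl_inj _ _ phi); rewrite e k0 hom1.
Qed.

Section Ratio.
Variables (m n : int) (m0 : m != 0%R) (n0 : n != 0%R).
Hypothesis sigmaE : forall x : H, sigma x ^^ n = x ^^ m.

Lemma ratio_unit_BS1 : nontrivial H -> (`|m| == 1)%R || (`|n| == 1)%R ->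
  has_subgroup_iso (semidirect phi) (BS 1 (m * n)).
Proof.
move=> [a a1] mn1; have [/eqP m1|/eqP n1] := orP mn1.
  have mm : (m * m = 1)%R by nia.
  apply: (@sigma_power_BS1 a t _ a1); first by left.
  apply: (mulgI t); apply: (mulIg t^-1); rewrite !mulgA mulgV mul1g mulgK.
  rewrite sd_inr_conj hom_expgz mulrC expgzM sigmaE -expgzM mm //.
have nn : (n * n = 1)%R by nia.
apply: (@sigma_power_BS1 a t^-1 _ a1); first by right.
by rewrite invgK sd_inr_conj mulrC expgzM -expgzAC -sigmaE -expgzM nn.
Qed.

Hypothesis cop : coprimez m n.

(** With u m + v n = 1, the element x^v sigma(x)^u is an n-th root of x, because
    sigma(x)^n = x^m; likewise x^u y^v is an m-th root of x when
    sigma(y) = x. *)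
Lemma ratio_roots (x : H) (N : nat) : exists y, y ^^ ((m * n) ^+ N)%R = x.
Proof.
have cH := locally_cyclic_commutative.
have /coprimezP[[u v] /= uv] := cop.
have rn (z : H) : exists y, y ^^ n = z.
  exists (z ^^ v * sigma z ^^ u); rewrite expgzMn; last exact: cH.
  rewrite -expgzM (expgzAC (sigma z)) sigmaE -expgzM -expgzD.
  by rewrite addrC [(m * u)%R]mulrC uv.
have rm (z : H) : exists y, y ^^ m = z.
  pose y := autact phi (- 1 : int)%R z.
  have yz : y ^^ m = z ^^ n by rewrite -sigmaE sigmaK.
  exists (z ^^ u * y ^^ v); rewrite expgzMn; last exact: cH.
  by rewrite -expgzM (expgzAC y) yz -expgzM -expgzD [(n * v)%R]mulrC uv.
elim: N x => [|N IHN] x; first by exists x.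
have [y yx] := rn x; have [z zy] := rm y; have [w wz] := IHN z.
by exists w; rewrite exprSr expgzM wz expgzM zy.
Qed.

(** The embedding of Z[1/mn] in H sends r to a^r, the element h with h^p = a^q
    whenever r = q/p: it exists by [ratio_roots] and is unique because roots are
    unique in a torsion-free abelian group. *)
Lemma ratio_Gmn : nontrivial H ->
  has_subgroup_iso (semidirect phi) (Gmn m0 n0).
Proof.
move=> [a a1]; have cH := locally_cyclic_commutative.
pose frac (r : rat) (h : H) := exists p q : int,
  [/\ p != 0, r * p%:~R = q%:~R & h ^^ p = a ^^ q]%R.
have frac_inj r h h' : frac r h -> frac r h' -> h = h'.
  move=> [p [q [p0 rq hq]]] [p' [q' [p'0 rq' hq']]].
  have pp0 : (p * p' != 0)%R by rewrite mulf_neq0.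
  apply: (expgz_root tfH (cH h h') _ pp0).
  rewrite [in RHS]mulrC !expgzM hq hq' -!expgzM; congr (_ ^^ _).
  apply: (@intr_inj rat); by rewrite !rmorphM /= -rq -rq' mulrAC.
have fracE (r : Zinv_group m0 n0) : exists h, frac (val r) h.
  have [N /(_ 0%N)[x]] := Zinv_pred_nat (valP r); rewrite addn0 => rE.
  have [y ya] := ratio_roots a N.
  exists (y ^^ x), ((m * n) ^+ N)%R, x; split.
  - by rewrite expf_neq0 // mulf_neq0.
  - rewrite rE rmorphXn rmorphM /= exprMn divfK //.
    by rewrite mulf_neq0 // expf_neq0 // intr_eq0.
  - by rewrite expgzAC ya.
have [rho rhoE] := choice fracE.
have [|i iE] :=
  @multiplicative_of (Zinv_group m0 n0) (semidirect phi) (inl \o rho).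
  move=> r s; rewrite /= -gmulfM; congr (inl _); apply: frac_inj (rhoE _) _.
  have [p [q [p0 rq hq]]] := rhoE r; have [p' [q' [p'0 sq hq']]] := rhoE s.
  exists (p * p')%R, (q * p' + q' * p)%R; split; first by rewrite mulf_neq0.
    rewrite (_ : val (r * s)%g = val r + val s)%R // rmorphD !rmorphM /=.
    rewrite -rq -sq.
    by rewrite mulrDl !mulrA (mulrAC (val s)).
  rewrite expgzMn; last exact: cH.
  by rewrite expgzD expgzM hq mulrC !expgzM hq'.
apply: (@sd_embeds _ _ (Zinv_action m0 n0) i t) => [r||r k].
- rewrite !iE sd_inr_conj; congr (inl _).
  apply/esym; apply: frac_inj (rhoE _) _.
  have [p [q [p0 rq hq]]] := rhoE r.
  exists (n * p)%R, (m * q)%R; split; first by rewrite mulf_neq0.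
    rewrite /= expr1z !rmorphM /= -rq.
    have cancel_n (x y z w : rat) :
      (y != 0 -> x / y * z * (y * w) = x * (z * w))%R.
      by move=> y0; field.
    by apply: cancel_n; rewrite intr_eq0.
  by rewrite expgzM sigmaE expgzAC hq expgzAC -expgzM mulrC.
- apply: hom_inj => r; rewrite iE -(hom1 inl) => /sd_inl_inj r1.
  have [p [q [p0 rq hq]]] := rhoE r; apply: val_inj => /=.
  have q0 : q = 0%R by apply: (expgz_inj tfH a1); rewrite -hq r1 expg1z.
  move/eqP: rq; rewrite q0 mulf_eq0 intr_eq0 (negbTE p0) orbF => /eqP ->.
  by [].
by rewrite iE; exact: inl_eq_t.
Qed.

End Ratio.
End LocallyCyclicByZ.

Lemma free_no_locally_cyclic_by_Z (G : groupType) :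
  torsion_free G -> BS_free G -> Gildenhuys_free G ->
  ~ exists (H : groupType) (phi : aut_action Zgroup H),
        [/\ nontrivial H, locally_cyclic H
          & has_subgroup_iso G (semidirect phi)].
Proof.
move=> tfG BSf Gf [H [phi [ntH lcH Gsd]]].
have /has_subgroup_isoP[f fI] := Gsd.
have tfH : torsion_free H.
  apply: (torsion_free_inj (f := f \o sd_inl phi)) tfG.
  exact: inj_comp fI (@sd_inl_inj _ _ _).
have [m [n [m0 n0 cop sE]]] := sigma_ratio phi tfH lcH ntH.
have [mn1|] := boolP ((`|m| == 1)%R || (`|n| == 1)%R).
  have mn0 : (m * n != 0)%R by rewrite mulf_neq0.
  apply: (BSf 1%R (m * n)%R (oner_neq0 _) mn0).
  apply: has_subgroup_iso_trans Gsd _.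
  exact: (ratio_unit_BS1 tfH m0 n0 sE ntH mn1).
rewrite negb_or => /andP[m1 n1].
apply: (Gf m n m0 n0 cop); [lia | lia |].
apply: has_subgroup_iso_trans Gsd _; exact: ratio_Gmn.
Qed.

Theorem theorem6p4 (G : groupType) (torsion_free_G : torsion_free G) :
  algebraically_hyperbolic G <->
  [/\ BS_free G, Gildenhuys_free G & Adian_free G].
Proof.
split=> [AHG | [BSf Gf Af]].
  split; [exact: AH_BS_free | exact: AH_Gildenhuys_free | exact: AH_Adian_free].
split=> //; first exact: free_commutative_transitive.
exact: free_no_locally_cyclic_by_Z.
Qed.
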